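(* Let $G$ be a connected $(P_7, C_4, \text{gem})$-free graph that has no clique cutset. If $G$ is not a clique blowup of the Petersen graph, then $G$ has a bisimplicial vertex.
   Context: All graphs are finite and simple. $P_t$, $C_t$ denote the path and cycle on $t$ vertices; $G$ is $H$-free if it has no induced subgraph isomorphic to $H$. A gem is the graph consisting of an induced $P_4$ plus a vertex adjacent to all four vertices of the $P_4$. A clique cutset of $G$ is a clique $K$ such that $G-K$ has more connected components than $G$. A clique blowup of a graph $H$ with $V(H)=\{v_1,\dots,v_n\}$ is any graph whose vertex set can be partitioned into $n$ nonempty cliques $A_1,\dots,A_n$ such that $A_i$ is complete to $A_j$ if $v_iv_j\in E(H)$ and $A_i$ is anticomplete to $A_j$ if $v_iv_j\notin E(H)$. A vertex is bisimplicial if its neighbourhood is the union of two cliques. *)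

(* Defs.v *)
From mathcomp Require Import all_boot.
Set Implicit Arguments. Unset Strict Implicit. Unset Printing Implicit Defensive.

Definition simple_graph (T : finType) (e : rel T) : Prop :=
  symmetric e /\ irreflexive e.

Definition contains_induced (T : finType) (e : rel T) (n : nat) (h : rel 'I_n) : Prop :=
  exists f : 'I_n -> T, injective f /\ forall i j, e (f i) (f j) = h i j.

Definition H_free (T : finType) (e : rel T) (n : nat) (h : rel 'I_n) : Prop :=
  ~ contains_induced e h.

Definition P7 : rel 'I_7 := fun i j => (i.+1 == j :> nat) || (j.+1 == i :> nat).

Definition C4 : rel 'I_4 :=
  fun i j => (i.+1 %% 4 == j :> nat) || (j.+1 %% 4 == i :> nat).

Definition gem : rel 'I_5 :=
  fun i j => [|| ((i < 4) && (j < 4) && ((i.+1 == j :> nat) || (j.+1 == i :> nat))),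
                 ((i == 4 :> nat) && (j < 4)) | ((j == 4 :> nat) && (i < 4))].

(* Petersen graph: outer 5-cycle 0..4, spokes i ~ i+5, inner pentagram
   5+i ~ 5+((i+2) mod 5). *)
Definition petersen_adj (a b : nat) : bool :=
  [|| (a < 5) && (b < 5) && (b == (a.+1) %% 5),
      (a < 5) && (b == a + 5)
    | (5 <= a < 10) && (5 <= b) && (b - 5 == (a - 5 + 2) %% 5)].

Definition petersen : rel 'I_10 :=
  fun i j => petersen_adj i j || petersen_adj j i.

Definition restr (T : finType) (e : rel T) (S : {set T}) : rel T :=
  fun x y => [&& x \in S, y \in S & e x y].

Definition comp_in (T : finType) (e : rel T) (S : {set T}) (x : T) : {set T} :=
  [set y in S | connect (restr e S) x y].

Definition ncomp (T : finType) (e : rel T) (S : {set T}) : nat :=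
  #|[set comp_in e S x | x in S]|.

Definition connected_graph (T : finType) (e : rel T) : Prop :=
  ncomp e [set: T] = 1.

Definition is_clique (T : finType) (e : rel T) (K : {set T}) : Prop :=
  forall x y, x \in K -> y \in K -> x != y -> e x y.

Definition clique_cutset (T : finType) (e : rel T) (K : {set T}) : Prop :=
  is_clique e K /\ ncomp e [set: T] < ncomp e (~: K).

Definition has_clique_cutset (T : finType) (e : rel T) : Prop :=
  exists K : {set T}, clique_cutset e K.

(* clique blowup of H : partition of V(G) into nonempty cliques A_i = f^-1(i),
   complete between A_i, A_j when ij is an edge, anticomplete otherwise *)
Definition clique_blowup (T : finType) (e : rel T) (n : nat) (h : rel 'I_n) : Prop :=
  exists f : T -> 'I_n,
    (forall i, exists x, f x = i) /\
    (forall x y, x != y -> f x = f y -> e x y) /\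
    (forall x y, f x != f y -> e x y = h (f x) (f y)).

Definition neighbourhood (T : finType) (e : rel T) (v : T) : {set T} :=
  [set u | e v u].

Definition bisimplicial (T : finType) (e : rel T) (v : T) : Prop :=
  exists A B : {set T}, is_clique e A /\ is_clique e B /\
    neighbourhood e v = A :|: B.

(* Main.v *)
(** In a [C4]- and gem-free graph a vertex whose neighbourhood has no stable set of size 3 is
bisimplicial, so assume that every vertex is the centre of a claw. There is a hole: if [a] and
[b] are nonadjacent neighbours of [v], their common neighbours form a clique, and a shortest path
from [a] to [b] outside that clique closes up with [v]; by [P7]-freeness the hole has length 5, 6
or 7. Around a hole [v_0, ..., v_(n-1)], let [A_i] consist of [v_i] and its clones. A claw at
[v_i] yields either a neighbour of [v_i] that misses [v_(i-1)] and [v_(i+1)], or two nonadjacent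
vertices that both see an edge [v_i v_(i+1)] or [v_(i-1) v_i]. Moreover, for a clique [K] of the
hole the union of the [A_i], [i] in [K], is a clique but not a cutset, so a vertex whose
neighbours on the hole lie in [K] is joined by a short path to one that attaches elsewhere. These
two rules create new vertices, whose adjacencies are limited to finitely many possibilities by the
forbidden subgraphs. A finite case analysis, carried out by a verified program, then excludes
holes of length 7, then 5 (unless there is a Petersen graph), then 6. The same analysis around a
Petersen graph shows that every other vertex is a clone of one of its vertices. *)
Require Import Defs.
From mathcomp Require Import all_boot.
Set Implicit Arguments. Unset Strict Implicit. Unset Printing Implicit Defensive.

(** * Enumerating the neighbourhoods of a new vertex *)

(* The graph induced on a list of vertices, newest first: each vertex has the row of its
   adjacencies to the vertices behind it in the list. *)
Definition graph := seq (seq bool).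

Fixpoint layout (A : Type) (r : A -> A -> bool) (s : seq A) : graph :=
  if s is x :: s' then [seq r x y | y <- s'] :: layout r s' else [::].

Fixpoint adjacent (g : graph) (i j : nat) : bool :=
  match g, i, j with
  | r :: _, 0, j'.+1 => nth false r j'
  | r :: _, i'.+1, 0 => nth false r i'
  | _ :: g', i'.+1, j'.+1 => adjacent g' i' j'
  | _, _, _ => false
  end.

(* The full adjacency matrix, with [None] on the diagonal. *)
Fixpoint full (g : graph) : seq (seq (option bool)) :=
  if g is r :: g' then
    (None :: map Some r) :: [seq Some p.1 :: p.2 | p <- zip r (full g')]
  else [::].

Definition is_adj (o : option bool) : bool := if o is Some b then b else false.
Definition is_nonadj (o : option bool) : bool :=
  if o is Some b then if b then false else true else false.

(* [narrow], [candidates] and [search] are an unverified backtracking search: what they find is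
   checked by [occurs]. Conditionals replace [&&] and [||], whose second argument the virtual
   machine always evaluates. *)
Fixpoint narrow (b : bool) (l : seq (option bool)) (c : seq bool) : seq bool :=
  match l, c with
  | o :: l', x :: c' =>
    (if x then if b then is_adj o else is_nonadj o else false) :: narrow b l' c'
  | _, _ => [::]
  end.

Fixpoint candidates (r : seq bool) (pl : seq (seq (option bool))) (c : seq bool) :
    seq bool :=
  match r, pl with
  | b :: r', l :: pl' => candidates r' pl' (narrow b l c)
  | _, _ => c
  end.

Fixpoint search (M : seq (seq (option bool))) (p : graph) (pos : seq nat)
    (pl : seq (seq (option bool))) : option (seq nat) :=
  if p is r :: p' then
    (fix try (c : seq bool) (M' : seq (seq (option bool))) (k : nat) :=
      match c, M' with
      | b :: c', l :: M'' =>
        if b then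
          match search M p' (k :: pos) (l :: pl) with
          | None => try c' M'' k.+1
          | o => o
          end
        else try c' M'' k.+1
      | _, _ => None
      end) (candidates r pl (nseq (size M) true)) M 0
  else Some pos.

Definition occurs (g p : graph) (l : seq nat) : bool :=
  [&& uniq l, all (fun i => i < size g) l & layout (adjacent g) l == p].

(* Only occurrences that put the last vertex of the pattern [p] on the newest vertex of [g] are
   searched for. *)
Definition finds (g : graph) (M : seq (seq (option bool))) (p : graph) : bool :=
  if size p <= size g then
    if search M (behead (rev p)) [:: 0] [:: head [::] M] is Some l
    then occurs g p l else false
  else false.

Fixpoint finds_any (g : graph) (M : seq (seq (option bool))) (F : seq graph) : bool :=
  if F is p :: F' then if finds g M p then true else finds_any g M F' else false.

Definition forbidden (F : seq graph) (g : graph) : bool := finds_any g (full g) F.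

(* If [R] contains the rows of all new vertices over a graph, then [grow F R h] contains those
   over its extension [h] by one vertex. *)
Definition grow (F : seq graph) (R : seq (seq bool)) (h : graph) : seq (seq bool) :=
  flatten [seq [seq r <- [:: true :: q; false :: q] | ~~ forbidden F (r :: h)] | q <- R].

Fixpoint rows (F : seq graph) (g : graph) : seq (seq bool) :=
  if g is r :: g' then grow F (rows F g') g else [:: [::]].

Lemma zip_map2 (A A1 A2 : Type) (f : A -> A1) (h : A -> A2) (s : seq A) :
  zip (map f s) (map h s) = [seq (f x, h x) | x <- s].
Proof. by elim: s => //= x s ->. Qed.

Lemma zip_mapr (A A1 A2 : Type) (h : A -> A2) (m : seq A1) (s : seq A) :
  zip m (map h s) = [seq (p.1, h p.2) | p <- zip m s].
Proof. by elim: s m => [|x s IH] [|b m] //=; rewrite IH. Qed.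

Lemma all_zip_or (A : Type) (P : pred A) (a b : seq bool) (s : seq A) :
  all (fun p => p.1 ==> P p.2) (zip a s) -> all (fun p => p.1 ==> P p.2) (zip b s) ->
  all (fun p => p.1 ==> P p.2) (zip [seq p.1 || p.2 | p <- zip a b] s).
Proof.
elim: s a b => [|x s IH] [|i a] [|j b] //= /andP[ix a_s] /andP[jx b_s].
by rewrite IH // andbT; case: i j ix jx => [] [].
Qed.

Lemma all_zip_false (A : Type) (P : pred A) (a : seq bool) (s : seq A) :
  all (fun p => p.1 ==> P p.2) (zip (map (fun=> false) a) s).
Proof. by elim: s a => [|x s IH] [|i a] /=. Qed.

Definition path_rel : rel nat := fun i j => (i.+1 == j) || (j.+1 == i).
Definition cycle_rel (n : nat) : rel nat :=
  fun i j => (i.+1 %% n == j) || (j.+1 %% n == i).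
Definition gem_rel : rel nat := fun i j =>
  [|| (i < 4) && (j < 4) && ((i.+1 == j) || (j.+1 == i)),
      (i == 4) && (j < 4) | (j == 4) && (i < 4)].
Definition petersen_rel : rel nat := fun i j => petersen_adj i j || petersen_adj j i.

Definition cycle_graph (n : nat) : graph := layout (cycle_rel n) (iota 0 n).
Definition petersen_graph : graph := layout petersen_rel (iota 0 10).

(* Up to symmetry every vertex of the pattern comes last in one of the orders. *)
Definition P7_orders := [:: [:: 6; 5; 4; 3; 2; 1; 0]; [:: 0; 6; 5; 4; 3; 2; 1];
  [:: 0; 1; 6; 5; 4; 3; 2]; [:: 0; 1; 2; 6; 5; 4; 3]].
Definition gem_orders := [:: [:: 3; 2; 1; 0; 4]; [:: 3; 2; 1; 4; 0]; [:: 3; 0; 2; 4; 1]].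

Definition forbidden0 : seq graph := Eval vm_compute in
  layout (cycle_rel 4) (iota 0 4) :: map (layout gem_rel) gem_orders
    ++ map (layout path_rel) P7_orders.
Definition forbidden7 : seq graph := Eval vm_compute in rcons forbidden0 (cycle_graph 7).
(** The search places pattern vertices from the end of the list, here 0, 1, ..., 9, so that each one
    after the first is adjacent to an earlier one. One order suffices, as the Petersen graph is
    vertex-transitive. *)
Definition petersen_pattern : graph :=
  Eval vm_compute in layout petersen_rel (rev (iota 0 10)).
Definition forbidden7P : seq graph := Eval vm_compute in rcons forbidden7 petersen_pattern.
Definition forbidden57P : seq graph := Eval vm_compute in rcons forbidden7P (cycle_graph 5).
Definition forbidden567P : seq graph := Eval vm_compute in rcons forbidden57P (cycle_graph 6).

Definition short_cliques (n : nat) : seq (seq nat) :=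
  [seq [:: i] | i <- iota 0 n] ++ [seq [:: i; i.+1 %% n] | i <- iota 0 n].

(** * Soundness of the enumeration *)

Section Graph.
Variables (T : finType) (e : rel T).
Hypotheses (e_sym : symmetric e) (e_irr : irreflexive e).
Implicit Types (x y z w : T) (xs ys zs : seq T) (F : seq graph).

Lemma size_layout (A : Type) (r : A -> A -> bool) (s : seq A) :
  size (layout r s) = size s.
Proof. by elim: s => //= x s ->. Qed.

Lemma adjacent_layout x0 xs i j : i < size xs -> j < size xs ->
  adjacent (layout e xs) i j = e (nth x0 xs i) (nth x0 xs j).
Proof.
elim: xs i j => //= x xs IH [|i] [|j] //=; rewrite ?ltnS.
- by move=> _ lt_j; rewrite (nth_map x0).
- by move=> lt_i _; rewrite (nth_map x0) // e_sym.
- exact: IH.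
Qed.

Lemma layout_nth x0 xs (l : seq nat) : all (fun i => i < size xs) l ->
  layout (adjacent (layout e xs)) l = layout e [seq nth x0 xs i | i <- l].
Proof.
elim: l => //= i l IH /andP[lt_i lt_l]; rewrite IH // -map_comp; congr (_ :: _).
by apply/eq_in_map => j lj /=; rewrite (adjacent_layout x0) // (allP lt_l).
Qed.

Definition entry x y : option bool := if x == y then None else Some (e x y).
Definition line xs w : seq (option bool) := [seq entry w y | y <- xs].
Definition row xs w : seq bool := [seq e w y | y <- xs].

Lemma entry_adj w u : is_adj (entry w u) = e w u.
Proof. by rewrite /entry; case: eqP => // ->; rewrite e_irr. Qed.

Lemma entry_nonadj w u : is_nonadj (entry w u) = (w != u) && ~~ e w u.
Proof. by rewrite /entry; case: eqP => //= _; case: (e w u). Qed.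

Lemma row_line xs w : map is_adj (line xs w) = row xs w.
Proof. by rewrite -map_comp; apply: eq_map => y /=; rewrite entry_adj. Qed.

Lemma line_new xs w : w \notin xs -> line xs w = map Some (row xs w).
Proof.
move=> w_new; rewrite -map_comp; apply/eq_in_map => y y_xs /=.
by rewrite /entry; case: eqP => // w_y; rewrite w_y y_xs in w_new.
Qed.

Lemma full_layout xs : uniq xs -> full (layout e xs) = [seq line xs x | x <- xs].
Proof.
elim: xs => //= x xs IH /andP[x_xs /IH->]; congr (_ :: _).
  by rewrite -(line_new x_xs) {1}/entry eqxx.
rewrite zip_map2 -map_comp; apply/eq_in_map => y y_xs /=.
rewrite /line /= [entry y x]/entry e_sym; case: (y =P x) => // y_x.
by rewrite -y_x y_xs in x_xs.
Qed.

Definition avoids F := forall p, p \in F -> forall zs, uniq zs -> layout e zs <> p.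

Lemma occursN F (p : graph) xs l : avoids F -> p \in F -> uniq xs ->
  occurs (layout e xs) p l = false.
Proof.
move=> noF pF uniq_xs; apply/negP => /and3P[uniq_l lt_l /eqP lay_l].
case: xs => [|x0 xs] in uniq_xs lt_l lay_l.
  case: l lt_l lay_l {uniq_l} => //= _ p0; exact: (noF p pF [::]).
rewrite size_layout in lt_l.
apply: (noF p pF [seq nth x0 (x0 :: xs) i | i <- l]); last by rewrite -layout_nth.
rewrite map_inj_in_uniq // => i j li lj /eqP.
by rewrite nth_uniq ?(allP lt_l) // => /eqP.
Qed.

Lemma forbiddenN F xs : avoids F -> uniq xs -> forbidden F (layout e xs) = false.
Proof.
move=> noF uniq_xs; rewrite /forbidden.
have: {subset F <= F} by [].
elim: {-2}F => //= p F' IH sF; rewrite IH => [|q qF']; last first.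
  by rewrite sF // inE qF' orbT.
rewrite /finds; case: leqP => // _; case: search => [l|] //.
by rewrite (occursN _ noF) ?sF ?mem_head.
Qed.

Definition complete (R : seq (seq bool)) xs := forall w, w \notin xs -> row xs w \in R.

(** The row of [w] over [x :: xs] is its row over [xs] with the bit [e w x] in front, and the filter
    drops only rows that would create a forbidden pattern. *)
Lemma grow_complete F R x xs : avoids F -> uniq (x :: xs) -> complete R xs ->
  complete (grow F R (layout e (x :: xs))) (x :: xs).
Proof.
move=> noF uniq_xxs RP w w_new; have:= w_new; rewrite inE negb_or => /andP[_ w_xs].
apply/flatten_mapP; exists (row xs w); first exact: RP.
rewrite mem_filter; apply/andP; split; last first.
  by rewrite !inE /=; case: (e w x); rewrite eqxx ?orbT.
by rewrite (@forbiddenN F (w :: x :: xs)) //= w_new.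
Qed.

Lemma rows_complete F xs : avoids F -> uniq xs -> complete (rows F (layout e xs)) xs.
Proof.
move=> noF; elim: xs => //= x xs IH uniq_xxs.
by apply: grow_complete => //; apply: IH; case/andP: uniq_xxs.
Qed.

(** * Leaving a clique *)

(* [D k] is the set of vertices at distance at most [k] from a final vertex within [keep]. *)
Definition layered (keep final : pred T) (D : nat -> pred T) : Prop :=
  [/\ forall x, D 0 x -> final x,
      forall k x, D k x -> keep x && D k.+1 x,
      forall k x, D k.+1 x -> ~~ D k x -> exists2 y, D k y & e x y,
      forall k x y, keep x -> D k y -> e x y -> D k.+1 x
    & forall x, keep x -> exists k, D k x].

(** [D] is a breadth-first search from the final vertices inside [keep]; it reaches every kept
    vertex because [t] is one of its sources. *)
Lemma layered_connect (keep final : pred T) t : keep t -> final t ->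
  (forall x, keep x -> connect (restr e [set x | keep x]) x t) ->
  exists D, layered keep final D.
Proof.
move=> t_keep t_final keep_t.
pose D := fix D k x := if k is k'.+1 then D k' x || keep x && [exists y, D k' y && e x y]
                       else keep x && final x.
have D_keep k x : D k x -> keep x by elim: k => [/andP[]|k IH /= /orP[/IH|/andP[]]].
exists D; split=> [x /andP[] //|k x Dx|k x /=|k x y x_keep Dy exy|x /keep_t/connectP[p]].
- by rewrite /= Dx (D_keep k).
- by case/orP=> [->//|/andP[_ /existsP[y /andP[Dy exy]]] _]; exists y.
- by rewrite /= x_keep; apply/orP; right; apply/existsP; exists y; rewrite Dy.
elim: p x => [x _ /= t_x|y p IH x /= /andP[/and3P[x_keep _ exy] /IH{}IH] /IH[k Dy]].
  by exists 0; rewrite /= -t_x t_keep.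
exists k.+1; rewrite inE in x_keep; rewrite /= x_keep; apply/orP; right.
by apply/existsP; exists y; rewrite Dy.
Qed.

Lemma clique_complement_connect (K : {set T}) x y :
  connected_graph e -> ~ has_clique_cutset e -> is_clique e K ->
  x \notin K -> y \notin K -> connect (restr e (~: K)) x y.
Proof.
move=> e_conn e_cut K_clique xK yK.
have le1 : ncomp e (~: K) <= 1.
  by rewrite -e_conn leqNgt; apply/negP => lt; apply: e_cut; exists K.
have comps z : z \notin K -> comp_in e (~: K) z \in [set comp_in e (~: K) z | z in ~: K].
  by move=> zK; apply: imset_f; rewrite inE.
have /card_le1_eqP/(_ _ _ (comps x xK) (comps y yK)) eq_xy := le1.
have: y \in comp_in e (~: K) y by rewrite !inE yK connect0.
by rewrite eq_xy !inE => /andP[].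
Qed.

(** * Rules for adding vertices to a configuration *)

Section Engine.
(* [g0] is the graph on a fixed list of base vertices, the last ones of every list. *)
Variables (F : seq graph) (g0 : graph).
Let n := size g0.
Let base_rows := [seq map is_adj l | l <- full g0].

(* A graph together with the possible rows of further vertices. *)
Definition state := (graph * seq (seq bool))%type.
Implicit Types (st : state) (sel : seq (option bool) -> bool).

Definition base (A : Type) (l : seq A) : seq A := drop (size l - n) l.

Definition children (sel : seq (option bool) -> bool) st : seq state :=
  [seq (r :: st.1, grow F st.2 (r :: st.1)) | r <- st.2 & sel (map Some r)].

(* The selected vertex may be one of the known ones, hence the first case. *)
Definition extend (sel : seq (option bool) -> bool) st : seq state :=
  if has sel (full st.1) then [:: st] else children sel st.

Definition pred_mod (i : nat) : nat := (i + n.-1) %% n.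
Definition succ_mod (i : nat) : nat := i.+1 %% n.

(** [is_nonadj] is false at [None], so the two hole neighbours of the base vertex [i] are themselves
    excluded. *)
Definition pendant (i : nat) (b : seq (option bool)) : bool :=
  [&& is_adj (nth None b i), is_nonadj (nth None b (pred_mod i))
    & is_nonadj (nth None b (succ_mod i))].

Definition on_edge (i j : nat) (b : seq (option bool)) : bool :=
  is_adj (nth None b i) && is_adj (nth None b j).

Definition add_pendant (i : nat) : state -> seq state :=
  extend (fun l => pendant i (base l)).

(** Unless the pair is known already, one of its vertices is new and is added first; [head None l]
    is then the entry of the second vertex at the first. *)
Definition add_pair (i j : nat) st : seq state :=
  let sel l := on_edge i j (base l) in
  let both l := has (fun p => p.1 && is_nonadj p.2) (zip (map sel (full st.1)) l) in
  if has (fun l => sel l && both l) (full st.1) then [:: st]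
  else flatten [seq extend (fun l => is_nonadj (head None l) && sel l) h
                | h <- children sel st].

(* For the vertex [w] with row [r], [covers i r] says that [w] sees all base neighbours of the
   base vertex [i]; this defines the class [A_i]. *)
Definition covers (i : nat) (r : seq bool) : bool := all2 implb (nth [::] base_rows i) r.
Definition removed (K : seq nat) (r : seq bool) : bool := has (covers^~ r) K.
Definition within (K : seq nat) (r : seq bool) : bool :=
  all (fun j => nth false r j ==> (j \in K)) (iota 0 n).

(* The known vertices outside the classes [A_i] from which no known path outside these classes
   leads to a vertex attached outside [K]. The soundness of [escape] does not depend on this
   choice. *)
Definition trapped (K : seq nat) (g : graph) : seq bool :=
  let k := size g - n in
  let ws := [seq (take k l, map is_adj (drop k l)) | l <- take k (full g)] in
  let inside := [seq ~~ removed (iota 0 n) l.2 | l <- ws] in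
  let away := [seq removed [seq i <- iota 0 n | i \notin K] l.2 | l <- ws] in
  let meets m l := has (fun p => p.1 && is_adj p.2) (zip m l) in
  let step m := [seq p.1.1 && (p.1.2 || meets m p.2.1) | p <- zip (zip inside m) ws] in
  let out := iter k step
    [seq p.1 && (~~ within K p.2.2 || meets away p.2.1) | p <- zip inside ws] in
  [seq p.1 && ~~ p.2 | p <- zip inside out].

Section Paths.
Variables (keep final : seq bool -> bool) (stop : state -> bool).

(* The next vertex of a shortest path to a final vertex: it sees the previous vertex, which is
   one of [near], and misses all earlier ones, those of [far]. *)
Definition steps (far near : seq bool) (l : seq (option bool)) : bool :=
  [&& all (fun p => p.1 ==> is_nonadj p.2) (zip far l),
      has (fun p => p.1 && is_adj p.2) (zip near l)
    & keep (map is_adj (base l))].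

(** Ending early is harmless: when a known vertex could be the next one, when [stop] holds or when
    [d] runs out, the current state is returned, and it carries no false claim. *)
Fixpoint paths (d : nat) (far near : seq bool) st : seq state :=
  if has (steps far near) (full st.1) then [:: st] else
  flatten [seq if final (base (head [::] h.1)) || stop h then [:: h]
               else if d is d'.+1 then
                 paths d' (false :: [seq p.1 || p.2 | p <- zip far near])
                   (true :: map (fun=> false) near) h
               else [:: h] | h <- children (steps far near) st].
End Paths.

(** The bound 7 is ample in a [P7]-free graph, since each new vertex prolongs an induced path. The
    path is cut short once its newest vertex is no longer trapped. *)
Definition escape (K : seq nat) st : seq state :=
  let q := trapped K st.1 in
  let ok l := within K (map is_adj (base l)) && ~~ removed K (map is_adj (base l)) in
  if has id q && all (fun p => p.1 ==> ok p.2) (zip q (full st.1)) && (size q <= size st.1)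
  then paths (fun r => ~~ removed K r) (fun r => ~~ within K r)
         (fun h => ~~ head false (trapped K h.1)) 7 (map (fun=> false) q) q st
  else [:: st].

(* A refutation is the list, in prefix order, of the rules applied in the search tree. *)
Inductive rule := Claw of nat | Conn of seq nat.

Section Refute.
Variables (pairs : bool) (Is : seq nat) (Ks : seq (seq nat)).

Definition apply_rule (ru : rule) st : seq state :=
  match ru with
  | Claw i =>
    if i \in Is then
      add_pendant i st ++
      if pairs then add_pair i (succ_mod i) st ++ add_pair (pred_mod i) i st else [::]
    else [:: st]
  | Conn K => if K \in Ks then escape K st else [:: st]
  end.

(** A branch is closed when its rule has no outcome; the rules left over after one branch are passed
    on to the next. *)
Fixpoint refute (d : nat) (rs : seq rule) st : option (seq rule) :=
  match d, rs with
  | d'.+1, ru :: rs' =>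
    foldl (fun o h => if o is Some s then refute d' s h else None) (Some rs')
      (apply_rule ru st)
  | _, _ => None
  end.

End Refute.

(** * Soundness of the rules *)

Variable cyc : seq T.
Hypotheses (noF : avoids F) (uniq_cyc : uniq cyc) (cyc_g0 : layout e cyc = g0).

Definition valid st xs : Prop :=
  [/\ uniq xs, exists ws, xs = ws ++ cyc, layout e xs = st.1 & complete st.2 xs].

Definition realized (s : seq state) : Prop := exists2 st, st \in s & exists xs, valid st xs.

Lemma size_cyc : size cyc = n.
Proof. by rewrite -(size_layout e) cyc_g0. Qed.

Lemma base_map (A : Type) (f : T -> A) xs : (exists ws, xs = ws ++ cyc) ->
  base [seq f y | y <- xs] = [seq f y | y <- cyc].
Proof.
case=> ws ->; rewrite /base size_map size_cat size_cyc addnK map_cat.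
by rewrite drop_size_cat ?size_map.
Qed.

Lemma children_realized sel st xs w : valid st xs -> w \notin xs -> sel (line xs w) ->
  exists2 h, h \in children sel st & valid h (w :: xs).
Proof.
case=> uniq_xs [ws def_xs] lay_xs RP w_xs sel_w.
have uniq_w : uniq (w :: xs) by rewrite /= w_xs.
exists (row xs w :: st.1, grow F st.2 (row xs w :: st.1)).
  apply/mapP; exists (row xs w) => //.
  by rewrite mem_filter -line_new // sel_w RP.
split=> //=; first by exists (w :: ws); rewrite def_xs.
  by rewrite lay_xs.
rewrite -lay_xs; exact: (grow_complete (x := w)).
Qed.

Lemma has_full sel st xs : valid st xs ->
  has sel (full st.1) = has (fun x => sel (line xs x)) xs.
Proof. by case=> uniq_xs _ <- _; rewrite full_layout // has_map. Qed.

Lemma extend_realized sel st xs w : valid st xs -> sel (line xs w) ->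
  realized (extend sel st).
Proof.
move=> st_xs sel_w; rewrite /extend; case: ifPn => [_|].
  by exists st; [rewrite inE | exists xs].
rewrite (has_full _ st_xs) => /hasPn no_sel.
have [/no_sel|w_xs] := boolP (w \in xs); first by rewrite sel_w.
by have [h hP h_xs] := children_realized st_xs w_xs sel_w; exists h => //; exists (w :: xs).
Qed.

Lemma add_pendant_realized i st xs w : valid st xs -> pendant i (line cyc w) ->
  realized (add_pendant i st).
Proof.
move=> st_xs w_i; apply: (extend_realized (w := w) st_xs).
by rewrite base_map //; case: st_xs.
Qed.

Lemma add_pair_realized i j st xs y z : valid st xs ->
  on_edge i j (line cyc y) -> on_edge i j (line cyc z) -> y != z -> ~~ e y z ->
  realized (add_pair i j st).
Proof.
move=> st_xs; have [uniq_xs ws_xs lay_xs _] := st_xs.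
have base_xs w : base (line xs w) = line cyc w by rewrite base_map.
rewrite /add_pair; case: ifPn => [_ *|].
  by exists st; [rewrite inE | exists xs].
rewrite (has_full _ st_xs) -lay_xs full_layout // => /hasPn no_both.
(* Two known vertices would contradict [no_both], so up to exchanging the two, [y] is new. *)
wlog y_xs: y z / y \notin xs => [gen|] y_ij z_ij yz eyz.
  have [y_xs|y_new] := boolP (y \in xs); last exact: (gen y z).
  have [z_xs|z_new] := boolP (z \in xs); last first.
    by apply: (gen z y); rewrite // 1?eq_sym 1?e_sym.
  have:= no_both y y_xs; rewrite base_xs y_ij /= -map_comp zip_map2 has_map.
  by move=> /hasPn/(_ z z_xs); rewrite /= base_xs z_ij entry_nonadj yz eyz.
pose sel l := on_edge i j (base l).
have sel_y : sel (line xs y) by rewrite /sel base_xs.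
have [h hP h_xs] := children_realized st_xs y_xs sel_y.
pose sel' l := is_nonadj (head None l) && sel l.
have sel_z : sel' (line (y :: xs) z).
  rewrite /sel' /sel base_map ?z_ij ?andbT /= ?entry_nonadj 1?eq_sym ?yz 1?e_sym //.
  by case: ws_xs => ws ->; exists (y :: ws).
have [st' st'P real] := extend_realized h_xs sel_z.
by exists st' => //; apply/flatten_mapP; exists h.
Qed.

(** Some near vertex is at distance [k.+1] from the final ones, no near vertex is closer, and the
    far ones are farther away. The next vertex [w] of a shortest path lies in [D k], so a far vertex
    that sees it would lie in [D k.+1]. *)
Lemma paths_realized keep final stop D d far near st xs k :
  layered (fun w => keep (row cyc w)) (fun w => final (row cyc w)) D ->
  valid st xs ->
  all (fun p => p.1 ==> (keep (row cyc p.2) && ~~ D k.+1 p.2)) (zip far xs) ->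
  all (fun p => p.1 ==> (keep (row cyc p.2) && ~~ D k p.2)) (zip near xs) ->
  has (fun p => p.1 && D k.+1 p.2) (zip near xs) ->
  realized (paths keep final stop d far near st).
Proof.
move=> [D0 Dkeep Dpred Dsucc Dtot].
have Dle m m' x : m <= m' -> D m x -> D m' x.
  move=> le_mm' Dmx; rewrite -(subnKC le_mm'); elim: (m' - m) => [|j IH]; rewrite ?addn0 //.
  by rewrite addnS; case/Dkeep/andP: IH.
elim: d far near st xs k => [|d IH] far near st xs k st_xs far_k near_k;
  case/hasP=> -[[] p] //= p_near Dp; have [_ ws_xs _ _] := st_xs.
all: have /= /andP[_ Dkp] := allP near_k _ p_near.
all: have [w Dw epw] := Dpred _ _ Dp Dkp.
all: have step_w : steps keep far near (line xs w).
  1,3: apply/and3P; split.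
  1,4: rewrite zip_mapr all_map; apply/allP => -[[] u] //= u_far;
       have /= /andP[far_u Du] := allP far_k _ u_far;
       rewrite entry_nonadj; apply/andP; split; [apply: contraNneq Du => <-|
       apply: contra Du; rewrite e_sym; apply: Dsucc];
       by [|have /Dkeep/andP[_] := Dw].
  1,3: rewrite zip_mapr has_map; apply/hasP; exists (true, p) => //=;
       by rewrite entry_adj e_sym.
  1,2: rewrite base_map // row_line; by case/Dkeep/andP: Dw.
all: rewrite /=; case: ifPn => [_|]; first by exists st; [rewrite inE | exists xs].
all: rewrite (has_full _ st_xs) => /hasPn no_step.
all: have [/no_step|w_xs] := boolP (w \in xs); first by rewrite step_w.
all: have [h hP h_xs] := children_realized st_xs w_xs step_w.
  exists h; last by exists (w :: xs).
  by apply/flatten_mapP; exists h => //; case: ifP; rewrite inE.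
case stopP: (final (base (head [::] h.1)) || stop h).
  exists h; last by exists (w :: xs).
  by apply/flatten_mapP; exists h; rewrite // stopP inE.
have [uniq_wxs ws_wxs lay_h _] := h_xs.
have base_h : base (head [::] h.1) = row cyc w.
  by rewrite -lay_h /= base_map.
(* The distance of [w] is [m.+1], positive because [w] is not final; the bounds known for [k] weaken
   to bounds for [m]. *)
have [m]: exists m, (m < k) && (D m.+1 w && ~~ D m w).
  have exD : exists j, D j w by exists k.
  case: (ex_minnP exD) => -[|m] Dmw minm.
    by rewrite base_h (D0 _ Dmw) in stopP.
  exists m; rewrite minm //= Dmw andTb.
  by apply/negP => /minm; rewrite ltnn.
case/and3P=> lt_mk Dm1 Dm.
have weaken j l : m < j ->
    all (fun p => p.1 ==> (keep (row cyc p.2) && ~~ D j p.2)) (zip l xs) ->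
    all (fun p => p.1 ==> (keep (row cyc p.2) && ~~ D m.+1 p.2)) (zip l xs).
  move=> lt_mj; apply: sub_all => -[[] u] //= /andP[-> Dj].
  by apply: contra Dj; apply: Dle.
have [|||st' st'P real] := IH (false :: [seq p.1 || p.2 | p <- zip far near])
    (true :: map (fun=> false) near) h (w :: xs) m h_xs.
- apply: (@all_zip_or _ (fun u => keep (row cyc u) && ~~ D m.+1 u)).
    by apply: weaken far_k; rewrite ltnS ltnW.
  exact: weaken near_k.
- rewrite /= Dm andbT; apply/andP; split; first by case/Dkeep/andP: Dw.
  exact: (@all_zip_false _ (fun u => keep (row cyc u) && ~~ D m u)).
- by rewrite /= Dm1.
exists st' => //; apply/flatten_mapP; exists h => //.
by rewrite stopP.
Qed.

Definition escapable (K : seq nat) : Prop :=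
  exists D, layered (fun w => ~~ removed K (row cyc w)) (fun w => ~~ within K (row cyc w)) D.

Lemma escape_realized K st xs : escapable K -> valid st xs ->
  realized (escape K st).
Proof.
move=> [D [D0 Dkeep Dpred Dsucc Dtot]] st_xs; have [uniq_xs ws_xs lay_xs _] := st_xs.
rewrite /escape; move: (trapped K st.1) => q.
case: ifPn => [|_]; last by exists st; [rewrite inE | exists xs].
case/andP=> /andP[has_q ok_q] le_q.
have {}ok_q :
    all (fun p => p.1 ==> (within K (row cyc p.2) && ~~ removed K (row cyc p.2))) (zip q xs).
  move: ok_q; rewrite -lay_xs full_layout // zip_mapr all_map.
  by apply: sub_all => -[b u] /=; rewrite base_map // row_line.
have /hasP[[[] p] //= p_q _] : has (fun p => p.1) (zip q xs).
  have: size q <= size xs by rewrite -(size_layout e) lay_xs.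
  elim: (q) (xs) has_q {ok_q} => [|b q' IH] [|x s] //= /orP[->//|/IH] has_q /has_q ->.
  by rewrite orbT.
have exk : exists k, has (fun p => p.1 && D k p.2) (zip q xs).
  have /= /andP[_ keep_p] := allP ok_q _ p_q.
  by have [k Dkp] := Dtot _ keep_p; exists k; apply/hasP; exists (true, p).
(* The path starts at a vertex of [q] nearest to a final one; distance 0 is impossible, as the base
   neighbours of these vertices lie in [K]. *)
case: (ex_minnP exk) => -[|k] has_k min_k.
  have /hasP[[[] u] //= u_q /D0] := has_k.
  by have /= /andP[->] := allP ok_q _ u_q.
refine (@paths_realized (fun r => ~~ removed K r) (fun r => ~~ within K r) _ D 7
  _ _ _ xs k _ _ _ _ _) => //.
  exact: (@all_zip_false _ (fun u => ~~ removed K (row cyc u) && ~~ D k.+1 u)).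
apply/allP => -[[] u] //= u_q; have /= /andP[_ ->] := allP ok_q _ u_q.
apply/negP => Dku; suff /min_k : has (fun p => p.1 && D k p.2) (zip q xs) by rewrite ltnn.
by apply/hasP; exists (true, u).
Qed.

Section RefuteSound.
Variables (pairs : bool) (Is : seq nat) (Ks : seq (seq nat)).

Definition claw_at (i : nat) : Prop :=
  (exists w, pendant i (line cyc w)) \/
  pairs /\ exists y z, [/\ y != z, ~~ e y z &
    on_edge i (succ_mod i) (line cyc y) && on_edge i (succ_mod i) (line cyc z) ||
    on_edge (pred_mod i) i (line cyc y) && on_edge (pred_mod i) i (line cyc z)].

Hypothesis claw_rule : forall i, i \in Is -> claw_at i.
Hypothesis connP : forall K, K \in Ks -> escapable K.

Lemma realized_sub s1 s2 : {subset s1 <= s2} -> realized s1 -> realized s2.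
Proof. by move=> sub12 [st /sub12 ? ?]; exists st. Qed.

Lemma apply_rule_realized ru st xs : valid st xs -> realized (apply_rule pairs Is Ks ru st).
Proof.
move=> st_xs; have real_st : realized [:: st] by exists st; [rewrite inE | exists xs].
case: ru => [i|K] /=; case: ifP => //; last first.
  by move/connP=> K_esc; apply: escape_realized st_xs.
move/claw_rule=> [[w w_i]|[-> [y [z [yz eyz]]]]].
  by apply: realized_sub (add_pendant_realized st_xs w_i) => h hP; rewrite mem_cat hP.
case/orP=> /andP[y_i z_i].
  apply: realized_sub (add_pair_realized st_xs y_i z_i yz eyz) => h hP.
  by rewrite !mem_cat hP !orbT.
apply: realized_sub (add_pair_realized st_xs y_i z_i yz eyz) => h hP.
by rewrite !mem_cat hP !orbT.
Qed.

Lemma refuteP d rs st xs : isSome (refute pairs Is Ks d rs st) -> ~ valid st xs.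
Proof.
elim: d rs st xs => // d IH [|ru rs] //= st xs.
set s := apply_rule _ _ _ ru st => ref_s st_xs.
have [h hs [ys h_ys]] : realized s by apply: apply_rule_realized st_xs.
elim: s (Some rs) ref_s hs => //= h' s IHs o ref_s; rewrite inE.
case/predU1P=> [def_h|]; last exact: IHs ref_s.
case: o ref_s => [rs1|]; last by elim: (s).
rewrite -def_h; have:= IH rs1 h ys; case: refute => [rs2 /(_ isT)//|_].
by elim: (s).
Qed.

End RefuteSound.

(* Up to symmetry, all possible rows of two distinct vertices over the base, with their
   adjacency. *)
Definition pair_types : seq (seq bool * seq bool * bool) :=
  let R0 := rows F g0 in
  let base_row := nth [::] base_rows in
  flatten [seq [seq (base_row j, base_row k, nth false (base_row j) k)
               | k <- iota 0 n & j != k] | j <- iota 0 n]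
  ++ flatten [seq [seq (r, base_row j, nth false r j) | j <- iota 0 n]
                  ++ [seq (behead q, r, head false q) | q <- grow F R0 (r :: g0)]
             | r <- R0].

Lemma nth_base_rows x0 j : j < n -> nth [::] base_rows j = row cyc (nth x0 cyc j).
Proof.
rewrite -size_cyc => lt_j; rewrite /base_rows -cyc_g0 full_layout // -map_comp (nth_map x0) //=.
exact: row_line.
Qed.

Lemma pair_typesP x y : x != y ->
  (row cyc x, row cyc y, e x y) \in pair_types \/
  (row cyc y, row cyc x, e x y) \in pair_types.
Proof.
move=> xy; rewrite /pair_types !mem_cat.
have index_n z : z \in cyc -> index z cyc \in iota 0 n.
  by move=> z_cyc; rewrite mem_iota add0n -size_cyc index_mem.
have base_row z : z \in cyc -> nth [::] base_rows (index z cyc) = row cyc z.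
  by move=> z_cyc; rewrite (nth_base_rows z) ?nth_index // -size_cyc index_mem.
have nth_row u z : z \in cyc -> nth false (row cyc u) (index z cyc) = e u z.
  by move=> z_cyc; rewrite (nth_map z) ?index_mem // nth_index.
have R0P : complete (rows F g0) cyc by rewrite -cyc_g0; apply: rows_complete.
have [x_cyc|x_new] := boolP (x \in cyc); have [y_cyc|y_new] := boolP (y \in cyc).
- left; apply/orP; left; apply/flatten_mapP; exists (index x cyc); first exact: index_n.
  apply/mapP; exists (index y cyc); last by rewrite !base_row // nth_row.
  rewrite mem_filter index_n // andbT.
  by apply: contra_neq xy => /(congr1 (nth x cyc)); rewrite !nth_index.
- right; apply/orP; right; apply/flatten_mapP; exists (row cyc y); first exact: R0P.
  rewrite mem_cat; apply/orP; left; apply/mapP; exists (index x cyc); first exact: index_n.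
  by rewrite base_row // nth_row // e_sym.
- left; apply/orP; right; apply/flatten_mapP; exists (row cyc x); first exact: R0P.
  rewrite mem_cat; apply/orP; left; apply/mapP; exists (index y cyc); first exact: index_n.
  by rewrite base_row // nth_row.
right; apply/orP; right; apply/flatten_mapP; exists (row cyc x); first exact: R0P.
rewrite mem_cat; apply/orP; right; apply/mapP.
exists (row (x :: cyc) y); last by rewrite /= e_sym.
have:= @grow_complete F (rows F g0) x cyc noF; rewrite /= x_new uniq_cyc cyc_g0.
by apply=> //; rewrite inE negb_or eq_sym xy.
Qed.

Definition separable (types : seq (seq bool * seq bool * bool)) (K : seq nat) : bool :=
  all (fun t => removed K t.1.1 && removed K t.1.2 ==> t.2) types
  && has (fun j => ~~ removed K (nth [::] base_rows j)
                   && ~~ within K (nth [::] base_rows j)) (iota 0 n).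

(** The first test in [separable] makes the removed vertices a clique. It is not a cutset, so every
    other vertex reaches the base vertex given by the second test, which attaches outside [K]. *)
Lemma separable_escapable K : connected_graph e -> ~ has_clique_cutset e ->
  separable pair_types K -> escapable K.
Proof.
move=> e_conn e_cut /andP[/allP K_ok /hasP[j]]; rewrite mem_iota add0n => /= lt_j.
have x0 : T by case: (cyc) size_cyc lt_j => [<-|].
rewrite (nth_base_rows x0) // => /andP[t_keep t_final].
apply: (layered_connect (t := nth x0 cyc j)) => // x x_keep.
pose K' := [set w | removed K (row cyc w)].
have K'_clique : is_clique e K'.
  move=> u w; rewrite !inE => Ku Kw /pair_typesP[] /K_ok /=; first by rewrite Ku Kw.
  by rewrite Ku Kw.
have:= clique_complement_connect e_conn e_cut K'_clique (x := x) (y := nth x0 cyc j).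
rewrite !inE => /(_ x_keep t_keep).
by congr (connect (restr e _) _ _); apply/setP => w; rewrite !inE.
Qed.

Lemma valid_start : valid (g0, rows F g0) cyc.
Proof. by split=> //=; [exists [::] | rewrite -cyc_g0; apply: rows_complete]. Qed.

End Engine.

(** * The computations *)

(* Certificates were obtained by greedily choosing a rule with the fewest outcomes. *)
Definition pair_cert : seq rule :=
  [:: Claw 2; Conn [:: 0; 1]; Conn [:: 2]; Claw 4; Conn [:: 3; 4]; Conn [:: 3; 4];
      Claw 4; Conn [:: 3; 4]; Claw 4; Claw 4; Conn [:: 4]; Conn [:: 2; 3];
      Conn [:: 0; 1]; Conn [:: 0; 1]; Conn [:: 4; 0]; Conn [:: 2; 3]; Conn [:: 3; 4];
      Conn [:: 0; 1]; Conn [:: 1; 2]].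

Definition pendant_cert : seq rule :=
  [:: Claw 0; Claw 1; Claw 2; Claw 3; Claw 4; Conn [:: 4]; Claw 4; Conn [:: 1];
      Conn [:: 1]; Conn [:: 1]; Conn [:: 3]; Claw 4; Claw 4; Conn [:: 3]; Claw 3;
      Claw 4; Conn [:: 2]; Conn [:: 2]; Claw 4; Conn [:: 1]; Conn [:: 0]; Claw 4;
      Claw 4; Claw 4; Conn [:: 1]; Conn [:: 0]; Conn [:: 2]; Conn [:: 2]; Claw 4; Claw 4].

(** The Petersen graph is triangle-free, so its nonempty cliques are its vertices and edges. *)
Definition petersen_cliques : seq (seq nat) :=
  [seq [:: j] | j <- iota 0 10]
  ++ [seq p <- [seq [:: j; k] | j <- iota 0 10, k <- iota 0 10] |
       if p is [:: j; k] then (j < k) && petersen_rel j k else false].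

Definition isolated_cert : seq rule :=
  [:: Conn [:: 0; 1]; Conn [:: 6]; Conn [:: 9]; Conn [:: 7]; Conn [:: 4]; Conn [:: 5];
      Conn [:: 8]; Conn [:: 3]; Conn [:: 2]].

(** For a vertex outside all classes, the base neighbours, if any, turn out to form a clique [K],
    and the single rule [Conn K] closes the state. *)
Definition petersen_cert (r : seq bool) : seq rule :=
  if [seq j <- iota 0 10 | nth false r j] is (_ :: _) as K then [:: Conn K]
  else isolated_cert.

Lemma separable_C6 :
  all (separable (cycle_graph 6) (pair_types forbidden57P (cycle_graph 6))) (short_cliques 6).
Proof. by vm_compute. Qed.

Lemma separable_C5 :
  all (separable (cycle_graph 5) (pair_types forbidden7P (cycle_graph 5))) (short_cliques 5).
Proof. by vm_compute. Qed.

Lemma separable_petersen :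
  all (separable petersen_graph (pair_types forbidden7 petersen_graph)) petersen_cliques.
Proof. by vm_compute. Qed.

Lemma refute_C7 :
  isSome (refute forbidden0 (cycle_graph 7) true (iota 0 7) [::] 4
    [seq Claw i | i <- [:: 0; 1; 3; 2; 1; 3; 1; 2]]
    (cycle_graph 7, rows forbidden0 (cycle_graph 7))).
Proof. by vm_compute. Qed.

Lemma refute_C6 :
  isSome (refute forbidden57P (cycle_graph 6) true (iota 0 6) (short_cliques 6) 4
    [:: Claw 0; Claw 2; Conn [:: 2; 3]; Conn [:: 0; 1]; Conn [:: 5; 0]]
    (cycle_graph 6, rows forbidden57P (cycle_graph 6))).
Proof. by vm_compute. Qed.

Lemma refute_C5_pair :
  all (fun st => isSome (refute forbidden7P (cycle_graph 5) true (iota 0 5) (short_cliques 5) 9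
                           pair_cert st))
    (add_pair forbidden7P (cycle_graph 5) 0 1 (cycle_graph 5, rows forbidden7P (cycle_graph 5))).
Proof. by vm_compute. Qed.

(** Here [pairs] is [false]: once [refute_C5_pair] has excluded pairs on an edge, a claw can only
    yield a pendant vertex. *)
Lemma refute_C5_pendant :
  isSome (refute forbidden7P (cycle_graph 5) false (iota 0 5) (short_cliques 5) 12 pendant_cert
    (cycle_graph 5, rows forbidden7P (cycle_graph 5))).
Proof. by vm_compute. Qed.

(* The base vertex of which the vertex with row [r] is a clone. *)
Definition spot (r : seq bool) : nat := find (fun i => covers petersen_graph i r) (iota 0 10).

Lemma refute_petersen :
  all (fun st => isSome (refute forbidden7 petersen_graph true [::] petersen_cliques 3
                           (petersen_cert (head [::] st.1)) st))
    (children forbidden7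
       (fun l => ~~ removed petersen_graph (iota 0 10) (map is_adj (base petersen_graph l)))
       (petersen_graph, rows forbidden7 petersen_graph)).
Proof. by vm_compute. Qed.

Lemma petersen_types :
  all (fun t =>
    removed petersen_graph (iota 0 10) t.1.1 && removed petersen_graph (iota 0 10) t.1.2 ==>
    (t.2 == (spot t.1.1 == spot t.1.2) || petersen_rel (spot t.1.1) (spot t.1.2)))
   (pair_types forbidden7 petersen_graph).
Proof. by vm_compute. Qed.

(* The base is [:: b; v; a], where [a] and [b] are nonadjacent neighbours of [v]; vertices that see
   both [a] and [b] are removed, and a path is complete once it sees [b]. *)
Lemma no_path_around_vertex :
  paths forbidden567P [:: [:: true; false]; [:: true]; [::]]
    (fun r => ~~ (nth false r 0 && nth false r 2)) (fun r => nth false r 0) (fun=> false) 7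
    [:: false; false; false] [:: false; false; true]
    ([:: [:: true; false]; [:: true]; [::]],
     rows forbidden567P [:: [:: true; false]; [:: true]; [::]])
  = [::].
Proof. by vm_compute. Qed.

(** * Claws and holes *)

(** [l] is the order in which a pattern lists the vertices of [h], so vertex [i] is sent to position
    [index i l] of [zs]. The boolean premise is decided by computation. *)
Lemma layout_of_induced n (h : rel 'I_n) (r : rel nat) (l : seq nat) zs : 0 < n ->
  (forall i j : 'I_n, h i j = r i j) ->
  all (fun i => (i \in l) && all (fun j =>
    adjacent (layout r l) (index i l) (index j l) == r i j) (iota 0 n)) (iota 0 n) ->
  H_free e h -> uniq zs -> layout e zs <> layout r l.
Proof.
move=> n_gt0 hr l_ok h_free uniq_zs lay_zs; apply: h_free.
have size_zs : size zs = size l by rewrite -(size_layout e) lay_zs size_layout.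
have lt_ord (i : 'I_n) : nat_of_ord i \in iota 0 n by rewrite mem_iota add0n /=.
have lt_index (i : 'I_n) : index (nat_of_ord i) l < size zs.
  by have /andP[il _] := allP l_ok _ (lt_ord i); rewrite size_zs index_mem.
have x0 : T by case: (zs) (lt_index (Ordinal n_gt0)).
exists (fun i : 'I_n => nth x0 zs (index (nat_of_ord i) l)); split=> [i j /eqP|i j].
  have /andP[il _] := allP l_ok _ (lt_ord i); have /andP[jl _] := allP l_ok _ (lt_ord j).
  rewrite nth_uniq // => /eqP/(congr1 (nth 0 l)); rewrite !nth_index // => ij.
  exact: val_inj.
rewrite -adjacent_layout // lay_zs hr.
by have /andP[_ /allP/(_ _ (lt_ord j))/eqP] := allP l_ok _ (lt_ord i).
Qed.

Lemma avoids_rcons F (p : graph) : avoids F ->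
  (forall zs, uniq zs -> layout e zs <> p) -> avoids (rcons F p).
Proof. by move=> noF no_p q; rewrite mem_rcons inE => /predU1P[->//|/noF]. Qed.

Lemma avoids_forbidden0 : H_free e P7 -> H_free e C4 -> H_free e gem -> avoids forbidden0.
Proof.
move=> noP7 noC4 nogem; rewrite (_ : forbidden0 = layout (cycle_rel 4) (iota 0 4) ::
  map (layout gem_rel) gem_orders ++ map (layout path_rel) P7_orders); last by vm_compute.
move=> p; rewrite inE => /predU1P[-> zs|].
  exact: layout_of_induced noC4.
rewrite mem_cat => /orP[] /mapP[l l_in ->] zs.
  apply: layout_of_induced nogem => //.
  by move: l l_in; apply/allP; vm_compute.
apply: layout_of_induced noP7 => //.
by move: l l_in; apply/allP; vm_compute.
Qed.

Definition claw (v a b c : T) : bool :=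
  [&& e v a, e v b, e v c & [&& a != b, a != c, b != c, ~~ e a b, ~~ e a c & ~~ e b c]].

Section ForbFree.
Hypothesis no_forbidden : avoids forbidden0.

Lemma common_neighbours_adjacent a b c d : e a c -> e a d -> e b c -> e b d ->
  a != b -> ~~ e a b -> c != d -> e c d.
Proof.
move=> ac ad bc bd ab nab cd; apply: contraT => ncd.
have neq u w : e u w -> u != w by apply: contraTneq => ->; rewrite e_irr.
case: (@no_forbidden (layout (cycle_rel 4) (iota 0 4)) _ [:: a; c; b; d]).
- by rewrite inE; apply/orP; left.
- by rewrite /= !inE !negb_or (eq_sym c b) ab cd !neq.
- by rewrite /= ac ad bd (e_sym c b) bc (negbTE nab) (negbTE ncd).
Qed.

Lemma neighbourhood_P4_free v a b c d : e v a -> e v b -> e v c -> e v d ->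
  e a b -> e b c -> e c d -> a != c -> ~~ e a c -> b != d -> ~~ e b d -> a != d -> e a d.
Proof.
move=> va vb vc vd ab bc cd ac nac bd nbd ad; apply: contraT => nad.
have neq u w : e u w -> u != w by apply: contraTneq => ->; rewrite e_irr.
case: (@no_forbidden (layout gem_rel [:: 3; 2; 1; 0; 4]) _ [:: d; c; b; a; v]).
- by rewrite !inE; apply/orP; right; apply/orP; left.
- rewrite /= !inE !negb_or (eq_sym d b) (eq_sym d a) (eq_sym c a) ac bd ad.
  by rewrite !neq // e_sym.
by rewrite /= !(e_sym _ v) (e_sym b a) (e_sym c b) (e_sym d c) (e_sym d b) (e_sym d a)
  (e_sym c a) va vb vc vd ab bc cd (negbTE nac) (negbTE nbd) (negbTE nad).
Qed.

Lemma clawfree_bisimplicial v : (forall a b c, ~~ claw v a b c) -> bisimplicial e v.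
Proof.
(* If [a] and [b] are nonadjacent, the neighbours of [v] that do not see [b], those that do not
   see [a], and those that see both are three cliques, and the last is complete to the first. *)
move=> noclaw.
have [/forall_inP N_clique|] :=
  boolP [forall (a | e v a), forall (b | e v b), (a != b) ==> e a b].
  exists (neighbourhood e v), set0; split; [|split; last by rewrite setU0].
    move=> a b; rewrite !inE => /N_clique/forall_inP Na /Na /implyP; exact.
  by move=> a b; rewrite inE.
case/forall_inPn=> a va /forall_inPn[b vb]; rewrite negb_imply => /andP[ab nab].
have {}va : e v a by []; have {}vb : e v b by [].
pose side x y := [set c | [&& e v c, (c == x) || e x c & ~~ e y c]].
pose M := [set c | [&& e v c, e a c & e b c]].
have side_clique x y : e v y -> x != y -> ~~ e x y -> is_clique e (side x y).
  move=> vy xy nxy c d; rewrite !inE => /and3P[vc xc nyc] /and3P[vd xd nyd] cd.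
  have y_out u : (u == x) || e x u -> y != u.
    by case/predU1P=> [->|xu]; [rewrite eq_sym | apply: contraNneq nxy => ->].
  by have:= noclaw y c d; rewrite /claw vy vc vd !y_out // cd nyc nyd /= negbK.
have sideM_clique c d : c \in side a b -> d \in M -> c != d -> e c d.
  rewrite !inE => /and3P[vc ac nbc] /and3P[vd ad bd] cd.
  case/predU1P: ac => [->//|ac]; apply: contraT => ncd.
  have cb : c != b by apply: contraNneq nab => <-.
  (* Otherwise [c], [a], [d], [b] is an induced path in the neighbourhood of [v], which makes a
     gem. *)
  have:= @neighbourhood_P4_free v c a d b; rewrite (e_sym c b) (negbTE nbc); apply=> //.
    by rewrite e_sym.
  by rewrite e_sym.
exists (side a b :|: M), (side b a); split; [|split].
- move=> c d; rewrite !in_setU; case/orP=> cA /orP[] dA cd.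
  + exact: side_clique cA dA cd.
  + exact: sideM_clique.
  + by rewrite e_sym; apply: sideM_clique; rewrite 1?eq_sym.
  + move: cA dA; rewrite !inE => /and3P[vc ac bc] /and3P[vd ad bd].
    exact: (@common_neighbours_adjacent a b).
- by apply: side_clique; rewrite // 1?eq_sym 1?e_sym.
apply/setP => c; rewrite !inE; case: (boolP (e v c)) => //= vc.
have [->|ca] := eqVneq c a; first by rewrite e_sym nab.
have [->|cb] := eqVneq c b; first by rewrite nab !orbT.
have:= noclaw a b c; rewrite /claw va vb vc ab nab (eq_sym a) ca (eq_sym b) cb /=.
by case: (e a c); case: (e b c).
Qed.

Lemma claw_at_of_claw n cyc i a b c x0 : layout e cyc = cycle_graph n ->
  i < n -> claw (nth x0 cyc i) a b c -> claw_at (cycle_graph n) cyc true i.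
Proof.
(* Unless some leaf misses both hole neighbours of the centre, two leaves see the same one. *)
move=> lay_cyc lt_i /and4P[va vb vc /and3P[ab ac /and4P[bc nab nac nbc]]].
have size_cyc' : size cyc = n by rewrite -(size_layout e) lay_cyc size_layout size_iota.
have size_g : size (cycle_graph n) = n by rewrite size_layout size_iota.
have nth_line w j : j < n -> nth None (line cyc w) j = entry w (nth x0 cyc j).
  by move=> lt_j; rewrite (nth_map x0) ?size_cyc'.
have n_gt0 : 0 < n by case: (n) lt_i.
have ltp : pred_mod (cycle_graph n) i < n by rewrite /pred_mod size_g ltn_mod.
have lts : succ_mod (cycle_graph n) i < n by rewrite /succ_mod size_g ltn_mod.
set v := nth x0 cyc i in va vb vc.
pose p := nth x0 cyc (pred_mod (cycle_graph n) i).
pose q := nth x0 cyc (succ_mod (cycle_graph n) i).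
pose near u w := (w == u) || e w u.
have leaf w : e v w -> claw_at (cycle_graph n) cyc true i \/ near p w \/ near q w.
  move=> vw; have [|p_w] := boolP (near p w); first by right; left.
  have [|q_w] := boolP (near q w); first by right; right.
  left; left; exists w; rewrite /pendant !nth_line // entry_adj e_sym vw !entry_nonadj.
  by move: p_w q_w; rewrite /near !negb_or => -> ->.
(* Of two distinct nonadjacent leaves near [u], neither can be [u] itself. *)
have pair u w z : e v w -> e v z -> w != z -> ~~ e w z -> near u w -> near u z ->
    e w u && e z u.
  move=> vw vz wz nwz /orP[/eqP w_u|wu] /orP[/eqP z_u|zu].
  - by rewrite w_u z_u eqxx in wz.
  - by rewrite w_u e_sym zu in nwz.
  - by rewrite z_u wu in nwz.
  by rewrite wu zu.
have both w z : e v w -> e v z -> w != z -> ~~ e w z ->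
    near p w && near p z || near q w && near q z -> claw_at (cycle_graph n) cyc true i.
  move=> vw vz wz nwz near_wz; right; split=> //; exists w, z; split=> //.
  rewrite /on_edge !nth_line // !entry_adj -/v -/p -/q !(e_sym _ v) vw vz !andbT /=.
  by case/orP: near_wz => /andP[nw nz]; rewrite (pair _ _ _ vw vz wz nwz nw nz) ?orbT.
case: (leaf a va) => // near_a; case: (leaf b vb) => // near_b; case: (leaf c vc) => // near_c.
case: near_a near_b near_c => na [] nb [] nc.
all: first [ by apply: (both a b); rewrite // na nb ?orbT
           | by apply: (both a c); rewrite // na nc ?orbT
           | by apply: (both b c); rewrite // nb nc ?orbT].
Qed.

(** * Excluding holes when every vertex is the centre of a claw *)

Section AllClaws.
Hypothesis claws : forall v, exists a b c, claw v a b c.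

Lemma cycle_claw_at n cyc i : layout e cyc = cycle_graph n -> i \in iota 0 n ->
  claw_at (cycle_graph n) cyc true i.
Proof.
rewrite mem_iota add0n => lay_cyc /= lt_i.
have size_c : size cyc = n by rewrite -(size_layout e) lay_cyc size_layout size_iota.
have x0 : T by case: (cyc) size_c lt_i => [<-|].
have [a [b [c abc]]] := claws (nth x0 cyc i).
exact: claw_at_of_claw abc.
Qed.

Lemma no_C7 zs : uniq zs -> layout e zs <> cycle_graph 7.
Proof.
move=> uniq_zs lay_zs.
have no_conn K : K \in [::] -> escapable (cycle_graph 7) zs K by [].
have := valid_start no_forbidden uniq_zs lay_zs.
exact: (refuteP no_forbidden lay_zs (fun i => cycle_claw_at lay_zs) no_conn refute_C7).
Qed.

Hypotheses (e_conn : connected_graph e) (e_cut : ~ has_clique_cutset e).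

Lemma cliques_escapable F g0 Ks cyc : avoids F -> uniq cyc -> layout e cyc = g0 ->
  all (separable g0 (pair_types F g0)) Ks -> forall K, K \in Ks -> escapable g0 cyc K.
Proof.
by move=> noF uniq_cyc lay_cyc /allP Ks_ok K /Ks_ok; apply: separable_escapable.
Qed.

Lemma no_C6 (no57P : avoids forbidden57P) zs : uniq zs -> layout e zs <> cycle_graph 6.
Proof.
move=> uniq_zs lay_zs.
have conn6 := cliques_escapable no57P uniq_zs lay_zs separable_C6.
have := valid_start no57P uniq_zs lay_zs.
exact: (refuteP no57P lay_zs (fun i => cycle_claw_at lay_zs) conn6 refute_C6).
Qed.

Section C5.
Hypothesis no7P : avoids forbidden7P.

Let conn5 zs : uniq zs -> layout e zs = cycle_graph 5 ->
  forall K, K \in short_cliques 5 -> escapable (cycle_graph 5) zs K.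
Proof.
by move=> uniq_zs lay_zs; apply: (cliques_escapable no7P uniq_zs lay_zs separable_C5).
Qed.

Lemma no_pair_01 zs y z : uniq zs -> layout e zs = cycle_graph 5 -> y != z -> ~~ e y z ->
  on_edge 0 1 (line zs y) -> on_edge 0 1 (line zs z) -> False.
Proof.
move=> uniq_zs lay_zs yz nyz y01 z01.
have st_zs := valid_start no7P uniq_zs lay_zs.
have [h h_in [xs]] := add_pair_realized no7P lay_zs st_zs y01 z01 yz nyz.
have ref_h := allP refute_C5_pair h h_in.
exact: (refuteP no7P lay_zs (fun i => cycle_claw_at lay_zs) (conn5 uniq_zs lay_zs) ref_h).
Qed.

Lemma no_C5 zs : uniq zs -> layout e zs <> cycle_graph 5.
Proof.
move=> uniq_zs lay_zs.
have pendants i : i \in iota 0 5 -> claw_at (cycle_graph 5) zs false i.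
  move=> i_in; case: (cycle_claw_at lay_zs i_in) => [|[_ [y [z [yz nyz]]]]]; first by left.
  have size_zs : size zs = 5 by rewrite -(size_layout e) lay_zs.
  have x0 : T by case: (zs) size_zs.
  (* Rotating the hole by [j] moves the edge after [j] to the edge [0 1], where [no_pair_01]
     applies. *)
  have rot_False j : j \in iota 0 5 -> on_edge j (succ_mod (cycle_graph 5) j) (line zs y) &&
      on_edge j (succ_mod (cycle_graph 5) j) (line zs z) -> False.
    move=> j_in /andP[y_j z_j].
    have lay_rot : layout e (rot j zs) = cycle_graph 5.
      have -> : rot j zs = [seq nth x0 zs k | k <- rot j (iota 0 5)].
        by rewrite map_rot -size_zs -/(mkseq _ _) mkseq_nth.
      rewrite -layout_nth //; last by apply/allP => k; rewrite mem_rot mem_iota size_zs.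
      by rewrite lay_zs; apply/eqP; move: j j_in {y_j z_j}; apply/allP; vm_compute.
    have rot_edge w : on_edge 0 1 (line (rot j zs) w) =
        on_edge j (succ_mod (cycle_graph 5) j) (line zs w).
      rewrite /line map_rot.
      case: (zs) size_zs j_in => [|? [|? [|? [|? [|? []]]]]] //= _.
      by rewrite !inE => /or4P[/eqP->|/eqP->|/eqP->|/predU1P[->|/eqP->]].
    by apply: (no_pair_01 _ lay_rot yz nyz); rewrite ?rot_uniq ?rot_edge.
  case/orP=> [/rot_False-/(_ i_in) //|].
  have: succ_mod (cycle_graph 5) (pred_mod (cycle_graph 5) i) = i /\
      pred_mod (cycle_graph 5) i \in iota 0 5.
    by move: i_in; rewrite !inE => /or4P[/eqP->|/eqP->|/eqP->|/predU1P[->|/eqP->]].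
  by case=> succ_pred p_in yz_pi; case: (rot_False _ p_in); rewrite succ_pred.
have := valid_start no7P uniq_zs lay_zs.
exact: (refuteP no7P lay_zs pendants (conn5 uniq_zs lay_zs) refute_C5_pendant).
Qed.

End C5.

(** * Existence of a hole *)

Lemma hole_exists : ~ avoids forbidden567P.
Proof.
move=> noF.
have [v _] : exists v : T, v \in T.
  have: 0 < ncomp e [set: T] by rewrite e_conn.
  by case/card_gt0P=> C /imsetP[v _ _]; exists v.
have [a [b [c /and4P[va vb _ /and3P[ab _ /and4P[_ nab _ _]]]]]] := claws v.
have neq u w : e u w -> u != w by apply: contraTneq => ->; rewrite e_irr.
have uniq_bva : uniq [:: b; v; a].
  by rewrite /= !inE negb_or eq_sym (neq v b) // eq_sym ab (neq v a).
have lay_bva : layout e [:: b; v; a] = [:: [:: true; false]; [:: true]; [::]].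
  by rewrite /= !(e_sym b) vb va (negbTE nab).
pose keep r := ~~ (nth false r 0 && nth false r 2).
pose final r := nth false r 0.
(* By [C4]-freeness the common neighbours of [a] and [b] form a clique; it is not a cutset, so [a]
   and [b] are joined outside it. *)
pose M := [set w | e w b && e w a].
have M_clique : is_clique e M.
  move=> x y; rewrite !inE => /andP[xb xa] /andP[yb ya] xy.
  by apply: (@common_neighbours_adjacent a b); rewrite // e_sym.
have conn_M x y : x \notin M -> y \notin M -> connect (restr e (~: M)) x y.
  exact: clique_complement_connect.
have aM : a \notin M by rewrite inE e_irr andbF.
have bM : b \notin M by rewrite inE e_irr.
(* [b] itself is not final, but its successor [t] on a path to [a] is. *)
have /connectP[[|t p] /=] := conn_M _ _ bM aM; first by move=> _ ba; rewrite ba eqxx in ab.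
case/andP=> /and3P[_ tM bt] _ _.
have [D layD] : exists D, layered (fun w => keep (row [:: b; v; a] w))
    (fun w => final (row [:: b; v; a] w)) D.
  apply: (layered_connect (t := t)); first by rewrite !inE in tM.
    by rewrite /final /= e_sym.
  move=> x x_far; have xM : x \notin M by rewrite inE.
  have:= conn_M _ _ xM _; rewrite in_setC in tM; move=> /(_ _ tM).
  by congr (connect (restr e _) _ _); apply/setP => w; rewrite !inE.
have a_keep : keep (row [:: b; v; a] a) by rewrite /keep /= e_irr andbF.
have [_ _ _ _ /(_ a a_keep) exk] := layD.
case: (ex_minnP exk) => k Dk min_k; have [D0 _ _ _ _] := layD.
case: k Dk min_k => [/D0|k Dk min_k]; first by rewrite /final /= (negbTE nab).
have nDk : ~~ D k a by apply/negP => /min_k; rewrite ltnn.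
have st_bva := valid_start noF uniq_bva lay_bva.
have [] := @paths_realized forbidden567P _ _ noF lay_bva keep final (fun=> false) D 7
  [:: false; false; false] [:: false; false; true] _ _ k layD st_bva.
- by [].
- by rewrite [zip _ _]/= [all _ _]/= a_keep nDk.
- by rewrite /= Dk.
by move=> st; rewrite no_path_around_vertex.
Qed.

(** * Clones of the vertices of a Petersen graph *)

Lemma petersen_blowup zs : avoids forbidden7 -> uniq zs -> layout e zs = petersen_graph ->
  clique_blowup e petersen.
Proof.
move=> noF uniq_zs lay_zs.
have no_claw i : i \in [::] -> claw_at petersen_graph zs true i by [].
have connP := cliques_escapable noF uniq_zs lay_zs separable_petersen.
have st_zs := valid_start noF uniq_zs lay_zs.
have size_zs : size zs = 10 by rewrite -(size_layout e) lay_zs.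
have lines i : i \in iota 0 10 ->
    spot (nth [::] [seq map is_adj l | l <- full petersen_graph] i) = i.
  by move=> i_in; apply/eqP; move: i i_in; apply/allP; vm_compute.
have covered w : removed petersen_graph (iota 0 10) (row zs w).
  have [w_in|w_new] := boolP (w \in zs).
    rewrite -(nth_index w w_in) -(nth_base_rows uniq_zs lay_zs); last first.
      by rewrite -index_mem size_zs in w_in.
    have: index w zs \in iota 0 10 by rewrite mem_iota -size_zs index_mem.
    by move: (index w zs); apply/allP; vm_compute.
  (* A vertex outside all classes would realize one of the states closed by [refute_petersen]. *)
  apply: contraT => w_out.
  pose sel l := ~~ removed petersen_graph (iota 0 10) (map is_adj (base petersen_graph l)).
  have sel_w : sel (line zs w).
    rewrite /sel (base_map lay_zs); last by exists [::].
    by rewrite row_line.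
  have [h h_in h_w] := children_realized noF st_zs w_new sel_w.
  have ref_h := allP refute_petersen h h_in.
  by case: (refuteP noF lay_zs no_claw connP ref_h h_w).
have lt_spot w : spot (row zs w) < 10.
  by have:= covered w; rewrite /removed has_find.
have edge x y : x != y ->
    e x y = (spot (row zs x) == spot (row zs y))
            || petersen_rel (spot (row zs x)) (spot (row zs y)).
  move=> xy; case: (pair_typesP noF uniq_zs lay_zs xy) => /(allP petersen_types)/implyP ok.
    exact: (eqP (ok (introT andP (conj (covered x) (covered y))))).
  rewrite eq_sym /petersen_rel [petersen_adj _ _ || _]orbC.
  exact: (eqP (ok (introT andP (conj (covered y) (covered x))))).
exists (fun w => Ordinal (lt_spot w)); split; [|split].
- move=> i; have x0 : T by case: (zs) size_zs.
  exists (nth x0 zs i); apply: val_inj => /=.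
  by rewrite -(nth_base_rows uniq_zs lay_zs) // lines // mem_iota /=.
- by move=> x y /edge -> /(congr1 val) eq_xy; rewrite [spot _ == _](introT eqP eq_xy).
- move=> x y xy; rewrite edge; last by apply: contraNneq xy => ->.
  by rewrite -val_eqE /= in xy; rewrite (negbTE xy).
Qed.

Lemma no_petersen zs : avoids forbidden7 -> ~ clique_blowup e petersen -> uniq zs ->
  layout e zs <> petersen_pattern.
Proof.
move=> noF no_blowup uniq_zs lay_zs; apply: no_blowup.
have size_zs : size zs = 10 by rewrite -(size_layout e) lay_zs.
have x0 : T by case: (zs) size_zs.
apply: (petersen_blowup (zs := [seq nth x0 zs i | i <- rev (iota 0 10)])) => //.
  by rewrite map_rev rev_uniq -size_zs -/(mkseq _ _) mkseq_nth.
by rewrite -layout_nth ?size_zs // lay_zs.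
Qed.

End AllClaws.

End ForbFree.

End Graph.

Theorem theorem1p3 (T : finType) (e : rel T) :
  simple_graph e ->
  connected_graph e ->
  H_free e P7 -> H_free e C4 -> H_free e gem ->
  ~ has_clique_cutset e ->
  ~ clique_blowup e petersen ->
  exists v : T, bisimplicial e v.
Proof.
move=> [e_sym e_irr] e_conn noP7 noC4 nogem e_cut no_blowup.
have no_forbidden := avoids_forbidden0 e_sym e_irr noP7 noC4 nogem.
have [/existsP[v /forallP v_ok]|] :=
  boolP [exists v, [forall a, forall b, forall c, ~~ claw e v a b c]].
  exists v; apply: (clawfree_bisimplicial e_sym e_irr no_forbidden) => a b c.
  by have /forallP/(_ b)/forallP := v_ok a.
rewrite negb_exists => /forallP all_claws.
have claws v : exists a b c, claw e v a b c.
  have := all_claws v; rewrite negb_forall => /existsP[a]; rewrite negb_forall => /existsP[b].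
  by rewrite negb_forall => /existsP[c]; rewrite negbK => abc; exists a, b, c.
(* Each excluded configuration becomes a forbidden pattern in the next search, which fixes the order
   7, Petersen, 5, 6. *)
have no7 : avoids e forbidden7 := avoids_rcons no_forbidden (no_C7 e_sym e_irr no_forbidden claws).
have no7P : avoids e forbidden7P := avoids_rcons no7
  (fun zs => no_petersen e_sym e_irr e_conn e_cut (zs := zs) no7 no_blowup).
have no57P : avoids e forbidden57P :=
  avoids_rcons no7P (no_C5 e_sym e_irr claws e_conn e_cut no7P).
have no567P : avoids e forbidden567P :=
  avoids_rcons no57P (no_C6 e_sym e_irr claws e_conn e_cut no57P).
by case: (hole_exists e_sym e_irr no_forbidden claws e_conn e_cut no567P).
Qed.
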